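(* Let $\mathbb F$ be a field of characteristic $0$. Let $\{\lambda^n/\mu^n\}_{n\ge0}$ be a graded skew partition sequence and for each $n\geq0$ put $u_n=h_{\lambda^n/\mu^n}$. Then the set $\{u_n\}_{n\geq0}$ is algebraically independent over $\mathbb F$ and generates $\Lambda_{\mathbb F}$ as an $\mathbb F$-algebra if and only if, for each $n\geq 1$, $\lambda_1^n\geq n$.
   Context: $\Lambda_{\mathbb F}$ is the ring of symmetric functions in infinitely many variables over $\mathbb F$, $h_\lambda=\prod_i h_{\lambda_i}$ are complete homogeneous symmetric functions, and the Hall inner product satisfies $\langle h_\lambda,m_\mu\rangle=\delta_{\lambda\mu}$ ($m_\mu$ monomial symmetric functions). A skew partition of $n$ is any pair $(\lambda,\mu)$ of partitions with $|\lambda|-|\mu|=n$, written $\lambda/\mu$ (containment not assumed); a graded skew partition sequence has $\lambda^n/\mu^n$ a skew partition of $n$ for each $n$. The skew complete function is defined by $\langle h_{\lambda/\mu},f\rangle=\langle h_\lambda,h_\mu f\rangle$ for all $f\in\Lambda_{\mathbb F}$. $\lambda^n_1$ is the largest part of $\lambda^n$.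
   Formalization: Algebraic independence is asserted for the u_n with n ≥ 1 rather than n ≥ 0, since u_0 is always a scalar (|λ^0| = |μ^0|) and so can never belong to an algebraically independent set; generation is still by all u_n with n ≥ 0. *)

(* Defs.v *)
From HB Require Import structures.
From mathcomp Require Import all_boot all_order all_fingroup all_algebra.
From mathcomp Require Import boolp.
From mathcomp Require Import mpoly.

Set Implicit Arguments.
Unset Strict Implicit.
Unset Printing Implicit Defensive.

Import GRing.Theory.

Local Open Scope ring_scope.

Record intpart := IntPart {
  parts :> seq nat;
  _ : sorted geq parts && (0%N \notin parts) }.

HB.instance Definition _ := [isSub for parts].
HB.instance Definition _ := [Equality of intpart by <:].

(* As n >= 0, this is |la| - |mu| = n; mu need not be contained in la. *)
Definition skew_partition (n : nat) (la mu : intpart) : Prop :=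
  sumn la = (sumn mu + n)%N.

Definition largest_part (la : intpart) : nat := head 0%N la.

(* The ring of symmetric functions, as the inverse limit, in the category of
   graded rings, of the rings of symmetric polynomials in n variables along the
   maps that set the last variable to 0. *)

Definition mrestr (R : comNzRingType) (n : nat) (p : {mpoly R[n.+1]}) :
    {mpoly R[n]} :=
  p \mPo [tuple (if unlift ord_max i is Some j then 'X_j else 0) | i < n.+1].

Record symfun (R : comNzRingType) := SymFun {
  sfval :> forall n, {mpoly R[n]};
  sf_sym : forall n, sfval n \is symmetric;
  sf_stable : forall n, mrestr (sfval n.+1) = sfval n;
  sf_bounded : exists d, forall n, (msize (sfval n) <= d)%N }.

Section Restriction.
Variables (R : comNzRingType) (n : nat).
Implicit Types p q : {mpoly R[n.+1]}.

Lemma mrestrD p q : mrestr (p + q) = mrestr p + mrestr q.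
Proof. exact: raddfD. Qed.

Lemma mrestrN p : mrestr (- p) = - mrestr p.
Proof. exact: raddfN. Qed.

Lemma mrestrM p q : mrestr (p * q) = mrestr p * mrestr q.
Proof. exact: rmorphM. Qed.

Lemma mrestrZ c p : mrestr (c *: p) = c *: mrestr p.
Proof. exact: linearZ. Qed.

Lemma mrestr0 : mrestr (0 : {mpoly R[n.+1]}) = 0.
Proof. exact: raddf0. Qed.

Lemma mrestr1 : mrestr (1 : {mpoly R[n.+1]}) = 1.
Proof. exact: rmorph1. Qed.

Lemma mrestrX (m : 'X_{1..n.+1}) :
  mrestr ('X_[m] : {mpoly R[n.+1]}) =
  if m ord_max == 0%N then 'X_[[multinom m (widen_ord (leqnSn n) i) | i < n]]
  else 0.
Proof.
rewrite /mrestr comp_mpolyX big_ord_recr /= tnth_mktuple unlift_none.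
rewrite expr0n; case: eqP => _; last by rewrite mulr0.
rewrite mulr1 [RHS]mpolyXE_id; apply: eq_bigr => i _.
rewrite tnth_mktuple mnmE.
have -> : widen_ord (leqnSn n) i = lift ord_max i.
  by apply: val_inj; rewrite /= /bump leqNgt ltn_ord.
by rewrite liftK.
Qed.

Lemma mcoeff_mrestr p (m : 'X_{1..n}) : (mrestr p)@_m = p@_(mnmwiden m).
Proof.
have -> : mrestr p = \sum_(k <- msupp p) p@_k *: mrestr 'X_[k].
  by rewrite {1}[p]mpolyE /mrestr raddf_sum; apply: eq_bigr => k _; rewrite -linearZ.
rewrite [in RHS](mpolyE p) !raddf_sum /=; apply: eq_bigr => k _.
rewrite !mcoeffZ mcoeffX mrestrX; congr (_ * _).
case: eqP => [k0|k0]; last first.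
  rewrite mcoeff0; case: eqP => // kE.
  by case: k0; rewrite kE mnmwiden_ordmax.
rewrite mcoeffX; congr ((nat_of_bool _)%:R); apply/eqP/eqP => [<-|->].
  apply/mnmP => i; case: (unliftP ord_max i) => [j|] ->.
    have -> : lift ord_max j = widen_ord (leqnSn n) j.
      by apply: val_inj; rewrite /= /bump leqNgt ltn_ord.
    by rewrite mnmwiden_widen mnmE.
  by rewrite mnmwiden_ordmax.
by apply/mnmP => i; rewrite mnmE mnmwiden_widen.
Qed.

End Restriction.

Section SymFunAlgebra.
Variable R : comNzRingType.
Implicit Types f g : symfun R.

Lemma symfunP f g : (forall n, f n = g n) -> f = g.
Proof.
case: f g => [f f1 f2 f3] [g g1 g2 g3] /= fg.
have {}fg : f = g by exact: functional_extensionality_dep.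
by subst g; congr SymFun; exact: Prop_irrelevance.
Qed.

HB.instance Definition _ := gen_eqMixin (symfun R).
HB.instance Definition _ := gen_choiceMixin (symfun R).

Lemma msize_bounded n (p : {mpoly R[n]}) d :
  (forall m, p@_m != 0 -> (mdeg m < d)%N) -> (msize p <= d)%N.
Proof.
move=> pd; rewrite msizeE big_seq_cond; apply: (big_ind (leq^~ d)) => //.
  by move=> i j id jd; rewrite geq_max id jd.
by move=> m; rewrite andbT mcoeff_msupp; exact: pd.
Qed.

Program Definition sf0 : symfun R := @SymFun R (fun=> 0) _ _ _.
Next Obligation. exact: rpred0. Qed.
Next Obligation. exact: mrestr0. Qed.
Next Obligation. by exists 0%N => n; rewrite msize0. Qed.

Program Definition sf1 : symfun R := @SymFun R (fun=> 1) _ _ _.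
Next Obligation. exact: rpred1. Qed.
Next Obligation. exact: mrestr1. Qed.
Next Obligation. by exists 1%N => n; rewrite msize1. Qed.

Program Definition sf_opp f : symfun R := @SymFun R (fun n => - f n) _ _ _.
Next Obligation. by rewrite rpredN sf_sym. Qed.
Next Obligation. by rewrite mrestrN sf_stable. Qed.
Next Obligation.
by case: (sf_bounded f) => d df; exists d => n; rewrite msizeN.
Qed.

Program Definition sf_add f g : symfun R :=
  @SymFun R (fun n => f n + g n) _ _ _.
Next Obligation. by rewrite rpredD ?sf_sym. Qed.
Next Obligation. by rewrite mrestrD !sf_stable. Qed.
Next Obligation.
case: (sf_bounded f) (sf_bounded g) => d df [e eg]; exists (maxn d e) => n.
by apply: leq_trans (msizeD_le _ _) _; rewrite geq_max !leq_max df eg orbT.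
Qed.

Program Definition sf_mul f g : symfun R :=
  @SymFun R (fun n => f n * g n) _ _ _.
Next Obligation. by rewrite rpredM ?sf_sym. Qed.
Next Obligation. by rewrite mrestrM !sf_stable. Qed.
Next Obligation.
case: (sf_bounded f) (sf_bounded g) => d df [e eg]; exists (d + e)%N => n.
apply: leq_trans (leq_add (df n) (eg n)).
apply: msize_bounded => m; rewrite -mcoeff_msupp => /msuppM_le /allpairsP.
case=> -[m1 m2] /= [m1f m2g ->]; rewrite mdegD.
exact: leq_trans (leq_add (msize_mdeg_lt m1f) (ltnW (msize_mdeg_lt m2g))).
Qed.

Program Definition sf_scale (c : R) f : symfun R :=
  @SymFun R (fun n => c *: f n) _ _ _.
Next Obligation. by rewrite rpredZ ?sf_sym. Qed.
Next Obligation. by rewrite mrestrZ sf_stable. Qed.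
Next Obligation.
case: (sf_bounded f) => d df; exists d => n.
exact: leq_trans (msizeZ_le _ _) (df n).
Qed.

Fact sf_addA : associative sf_add.
Proof. by move=> f g h; apply: symfunP => n /=; rewrite addrA. Qed.
Fact sf_addC : commutative sf_add.
Proof. by move=> f g; apply: symfunP => n /=; rewrite addrC. Qed.
Fact sf_add0 : left_id sf0 sf_add.
Proof. by move=> f; apply: symfunP => n /=; rewrite add0r. Qed.
Fact sf_addN : left_inverse sf0 sf_opp sf_add.
Proof. by move=> f; apply: symfunP => n /=; rewrite addNr. Qed.

HB.instance Definition _ :=
  GRing.isZmodule.Build (symfun R) sf_addA sf_addC sf_add0 sf_addN.

Fact sf_mulA : associative sf_mul.
Proof. by move=> f g h; apply: symfunP => n /=; rewrite mulrA. Qed.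
Fact sf_mulC : commutative sf_mul.
Proof. by move=> f g; apply: symfunP => n /=; rewrite mulrC. Qed.
Fact sf_mul1 : left_id sf1 sf_mul.
Proof. by move=> f; apply: symfunP => n /=; rewrite mul1r. Qed.
Fact sf_mulDl : left_distributive sf_mul sf_add.
Proof. by move=> f g h; apply: symfunP => n /=; rewrite mulrDl. Qed.
Fact sf_1neq0 : sf1 != sf0.
Proof.
by apply/eqP => /(congr1 (fun f => f 0%N)) /= /eqP; rewrite oner_eq0.
Qed.

HB.instance Definition _ := GRing.Zmodule_isComNzRing.Build (symfun R)
  sf_mulA sf_mulC sf_mul1 sf_mulDl sf_1neq0.

Fact sf_scaleA c d f : sf_scale c (sf_scale d f) = sf_scale (c * d) f.
Proof. by apply: symfunP => n /=; rewrite scalerA. Qed.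
Fact sf_scale1 : left_id 1 sf_scale.
Proof. by move=> f; apply: symfunP => n /=; rewrite scale1r. Qed.
Fact sf_scaleDr : right_distributive sf_scale +%R.
Proof. by move=> c f g; apply: symfunP => n /=; rewrite scalerDr. Qed.
Fact sf_scaleDl f : {morph sf_scale^~ f : c d / c + d}.
Proof. by move=> c d; apply: symfunP => n /=; rewrite scalerDl. Qed.

HB.instance Definition _ := GRing.Zmodule_isLmodule.Build R (symfun R)
  sf_scaleA sf_scale1 sf_scaleDr sf_scaleDl.

Fact sf_scaleAl (c : R) f g : c *: (f * g) = (c *: f) * g.
Proof. by apply: symfunP => n /=; rewrite scalerAl. Qed.

HB.instance Definition _ := GRing.Lmodule_isLalgebra.Build R (symfun R) sf_scaleAl.
HB.instance Definition _ := GRing.Lalgebra_isComAlgebra.Build R (symfun R).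

End SymFunAlgebra.

Lemma mdeg_mnmwiden n (m : 'X_{1..n}) : mdeg (mnmwiden m) = mdeg m.
Proof.
rewrite !mdegE big_ord_recr /= mnmwiden_ordmax addn0.
by apply: eq_bigr => i _; rewrite mnmwiden_widen.
Qed.

Section MonomialSums.
Variables (R : comNzRingType) (d : nat) (P : forall n, pred 'X_{1..n}).
Hypothesis P_perm : forall n (s : 'S_n) (m : 'X_{1..n}),
  P [multinom m (s i) | i < n] = P m.
Hypothesis P_widen : forall n (m : 'X_{1..n}), P (mnmwiden m) = P m.

Let monsum n : {mpoly R[n]} := \sum_(m : 'X_{1..n < d.+1} | P m) 'X_[m].

Lemma mcoeff_monsum n (m : 'X_{1..n}) :
  (monsum n)@_m = ((mdeg m <= d)%N && P m)%:R.
Proof.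
rewrite /monsum raddf_sum /=.
case: (boolP ((mdeg m <= d)%N && P m)) => [/andP[dm Pm]|nPm].
  rewrite (bigD1 (BMultinom (dm : mdeg m < d.+1)%N)) //= mcoeffX eqxx.
  rewrite big1 ?addr0 // => m' /andP[_].
  by rewrite -val_eqE mcoeffX /= => /negPf->.
rewrite big1 // => m' Pm'; rewrite mcoeffX; case: eqP => // m'E.
by case/negP: nPm; rewrite -m'E Pm' andbT -ltnS bmdeg.
Qed.

Lemma monsum_sym n : monsum n \is symmetric.
Proof.
apply/issymP => s; apply/mpolyP => m.
by rewrite mcoeff_sym !mcoeff_monsum mdeg_mperm P_perm.
Qed.

Lemma monsum_stable n : mrestr (monsum n.+1) = monsum n.
Proof.
apply/mpolyP => m; rewrite mcoeff_mrestr !mcoeff_monsum P_widen.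
by rewrite mdeg_mnmwiden.
Qed.

Lemma monsum_bounded : exists b, forall n, (msize (monsum n) <= b)%N.
Proof.
exists d.+1 => n; apply: msize_bounded => m; rewrite mcoeff_monsum ltnS.
by case: leqP => //; rewrite eqxx.
Qed.

End MonomialSums.

Definition exponents n (m : 'X_{1..n}) : seq nat :=
  [seq e <- (m : seq nat) | e != 0%N].

Lemma perm_exponents n (s : 'S_n) (m : 'X_{1..n}) :
  perm_eq (exponents [multinom m (s i) | i < n]) (exponents m).
Proof. by apply/perm_filter/tuple_permP; exists s. Qed.

Lemma exponents_widen n (m : 'X_{1..n}) : exponents (mnmwiden m) = exponents m.
Proof. by rewrite /exponents filter_rcons. Qed.

Program Definition complete (R : comNzRingType) (k : nat) : symfun R :=
  @SymFun R (fun n => \sum_(m : 'X_{1..n < k.+1} | mdeg m == k) 'X_[m]) _ _ _.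
Next Obligation.
by apply: (@monsum_sym R k (fun n m => mdeg m == k)) => i s m; rewrite mdeg_mperm.
Qed.
Next Obligation.
by apply: (@monsum_stable R k (fun n m => mdeg m == k)) => i m;
  rewrite mdeg_mnmwiden.
Qed.
Next Obligation. exact: (@monsum_bounded R k (fun n m => mdeg m == k)). Qed.

(* In n variables this is 0 when mu has more than n parts. *)
Program Definition monomial (R : comNzRingType) (mu : intpart) : symfun R :=
  @SymFun R (fun n => \sum_(m : 'X_{1..n < (sumn mu).+1} |
                           perm_eq (exponents m) mu) 'X_[m]) _ _ _.
Next Obligation.
apply: (@monsum_sym R (sumn mu) (fun n m => perm_eq (exponents m) mu)).
by move=> i s m; exact: (permPl (perm_exponents s m) _).
Qed.
Next Obligation.
apply: (@monsum_stable R (sumn mu) (fun n m => perm_eq (exponents m) mu)).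
by move=> i m; rewrite exponents_widen.
Qed.
Next Obligation.
exact: (@monsum_bounded R (sumn mu) (fun n m => perm_eq (exponents m) mu)).
Qed.

Definition complete_part (R : comNzRingType) (la : intpart) : symfun R :=
  \prod_(k <- la) complete R k.

Definition choose_or (T : Type) (x0 : T) (P : T -> Prop) : T :=
  if pselect (exists x, P x) is left exP then sval (cid exP) else x0.

Definition is_hall (R : comNzRingType) (B : symfun R -> symfun R -> R) : Prop :=
  [/\ forall f, scalar (B f),
      forall g, scalar (B^~ g)
    & forall la mu, B (complete_part R la) (monomial R mu) = (la == mu)%:R].

(* The h_la and the m_mu are bases of the ring of symmetric functions, so exactly
   one B satisfies is_hall, and the default value plays no role. *)
Definition hall (R : comNzRingType) : symfun R -> symfun R -> R :=
  choose_or (fun _ _ => 0) (@is_hall R).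

(* The linear form on the right vanishes on m_nu unless |nu| = |la| - |mu|, so it
   is represented by a finite combination of the h_nu, the dual basis; again
   there is exactly one such u. When |la| = |mu| it is a scalar, so in a graded
   sequence h_{la^0/mu^0} cannot belong to an algebraically independent set. *)
Definition skew_complete (R : comNzRingType) (la mu : intpart) : symfun R :=
  choose_or 0 (fun u => forall f,
    hall u f = hall (complete_part R la) (complete_part R mu * f)).

Section Generators.
Variables (F : fieldType) (A : comAlgType F) (x : nat -> A).

Definition evalN (N : nat) (p : {mpoly F[N]}) : A :=
  mmap (in_alg A) (fun i : 'I_N => x i) p.

Definition alg_independent : Prop :=
  forall (N : nat) (p : {mpoly F[N]}), evalN p = 0 -> p = 0.

Definition alg_generates : Prop :=
  forall a : A, exists (N : nat) (p : {mpoly F[N]}), a = evalN p.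

End Generators.

(* Main.v *)
(* Write p_k for the monomial symmetric function m_(k). Expanded in the basis dual
   to the m_nu, the coefficient of h_n in u_n is the coefficient of x^{lambda^n}
   in h_{mu^n} p_n. Since p_n = sum_j x_j^n and h_{mu^n} has positive integer
   coefficients on all monomials of its degree, this coefficient is a nonnegative
   integer, positive exactly when some part of lambda^n is at least n. If it
   vanishes for some n >= 1, then every u_k lies in the span of the h_nu with
   nu <> (n); this span is a subalgebra, as (n) is not the union of two partitions
   different from (n), and it misses h_n. If it never vanishes, then the u_n are
   triangular with respect to the h_n, so they generate; independence follows by
   counting, degree by degree. That the h_nu themselves are a basis is obtained in
   the same way, after Newton's identities and, in characteristic 0, an induction
   on the number of parts have shown that the products of the h_k span. *)
Require Import Defs.
From mathcomp Require Import boolp.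
From mathcomp Require Import all_boot all_fingroup all_algebra mpoly.

Set Implicit Arguments.
Unset Strict Implicit.
Unset Printing Implicit Defensive.

Import GRing.Theory.

(** * Partitions and exponent vectors *)

Section Partitions.
Local Open Scope nat_scope.
Implicit Types (s : seq nat) (la nu : intpart).

Lemma intpart_sorted la : sorted geq la.
Proof. by case: la => s /= /andP[]. Qed.

Lemma intpart_neq0 la : 0 \notin (la : seq nat).
Proof. by case: la => s /= /andP[]. Qed.

Lemma mkpart_subproof s : sorted geq (sort geq [seq k <- s | k != 0]) &&
  (0 \notin sort geq [seq k <- s | k != 0]).
Proof.
rewrite sort_sorted ?mem_sort ?mem_filter //.
by move=> x y; exact: leq_total.
Qed.

(** The underlying sequence is inferred from the type of [mkpart_subproof]; zeros are dropped, so
    exponent vectors can be passed directly. *)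
Definition mkpart s : intpart := IntPart (mkpart_subproof s).

Lemma perm_mkpart s : perm_eq (mkpart s) [seq k <- s | k != 0].
Proof. by rewrite perm_sort. Qed.

Lemma intpart_eq la nu : perm_eq la nu -> la = nu.
Proof.
move=> p; apply: val_inj.
apply: (sorted_eq _ _ (intpart_sorted la) (intpart_sorted nu) p).
  by move=> y x z /= xy yz; exact: leq_trans yz xy.
by move=> x y /andP[/= xy yx]; apply/eqP; rewrite eqn_leq xy yx.
Qed.

Lemma filter_intpart la : [seq k <- (la : seq nat) | k != 0] = la.
Proof.
apply/all_filterP/allP => k kla; apply/eqP => k0.
by move: (intpart_neq0 la); rewrite -k0 kla.
Qed.

Lemma mkpart_eq s la : perm_eq [seq k <- s | k != 0] la -> mkpart s = la.
Proof.
by move=> p; apply: intpart_eq; exact: perm_trans (perm_mkpart _) p.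
Qed.

Lemma sumn_mkpart s : sumn (mkpart s) = sumn s.
Proof.
rewrite (perm_sumn (perm_mkpart s)).
by elim: s => //= -[|k] s /= ->.
Qed.

Lemma size_intpart la : size la <= sumn la.
Proof.
move: (intpart_neq0 la); elim: (la : seq nat) => //= k s IH.
rewrite inE negb_or eq_sym => /andP[k0 /IH H].
by rewrite -(addn1 (size s)) addnC leq_add // lt0n.
Qed.

Lemma mem_sumn s k : k \in s -> k <= sumn s.
Proof.
elim: s => //= j s IH; rewrite inE => /predU1P[->|/IH h]; first exact: leq_addr.
exact: leq_trans h (leq_addl _ _).
Qed.

Definition mnm_of_seq n s : 'X_{1..n} := [multinom nth 0 s i | i < n].

Lemma exponents_mnm_of_seq n s : size s <= n ->
  exponents (mnm_of_seq n s) = [seq k <- s | k != 0].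
Proof.
move=> sn; have -> : exponents (mnm_of_seq n s) =
    [seq k <- s ++ nseq (n - size s) 0 | k != 0].
  rewrite /exponents; congr filter; apply: (@eq_from_nth _ 0).
    by rewrite size_tuple size_cat size_nseq subnKC.
  move=> i; rewrite size_tuple => ilt.
  rewrite -[i]/(val (Ordinal ilt)) -(mnm_nth 0) mnmE nth_cat nth_nseq /= if_same.
  by case: ltnP => // /(nth_default 0).
by rewrite filter_cat -[RHS]cats0; congr cat; elim: (n - size s).
Qed.

(** The number of variables is fixed, so the nonzero exponents determine how many zeros there
    are. *)
Lemma perm_exponents_inj n (m1 m2 : 'X_{1..n}) :
  perm_eq (exponents m1) (exponents m2) -> perm_eq m1 m2.
Proof.
move=> p; apply/allP => /= x _; apply/eqP; case: (eqVneq x 0) => [->|x0].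
  have cnt (m : 'X_{1..n}) : count_mem 0 m = n - size (exponents m).
    rewrite size_filter -[X in X - _](size_tuple m).
    rewrite -(count_predC (fun x => x != 0) m) addKn.
    by apply: eq_count => y /=; rewrite negbK.
  by rewrite !cnt (perm_size p).
have cnt (m : 'X_{1..n}) : count_mem x m = count_mem x (exponents m).
  rewrite count_filter; apply: eq_count => y /=.
  by case: eqP => // ->; rewrite x0.
by rewrite !cnt; move/seq.permP: p; apply.
Qed.

Lemma mdeg_exponents n (m : 'X_{1..n}) : mdeg m = sumn (exponents m).
Proof.
rewrite mdegE /exponents.
have -> (s : seq nat) : sumn [seq e <- s | e != 0] = sumn s.
  by elim: s => //= -[|k] s /= ->.
rewrite sumnE big_tuple.
by apply: eq_bigr => i _; rewrite mnm_tnth.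
Qed.

Lemma mdeg_mnm_of_seq s : mdeg (mnm_of_seq (size s) s) = sumn s.
Proof.
rewrite mdegE sumnE (big_nth 0) big_mkord.
by apply: eq_bigr => i _; rewrite mnmE.
Qed.

(** A partition of size at most [d] has at most [d] parts, so the finite type of monomials of degree
    at most [d] in [d] variables reaches all of them. *)
Definition parts_le d : seq intpart :=
  undup [seq mkpart (bmnm m) | m <- enum {: 'X_{1..d < d.+1}}].

Lemma mem_parts_le d la : (la \in parts_le d) = (sumn la <= d).
Proof.
rewrite mem_undup; apply/mapP/idP => [[m _ ->]|lad].
  by rewrite -ltnS sumn_mkpart; have := bmdeg m; rewrite mdegE sumnE big_tuple;
     under eq_bigr do rewrite mnm_tnth.
have szd : size la <= d := leq_trans (size_intpart la) lad.
have md : mdeg (mnm_of_seq d la) < d.+1.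
  by rewrite mdeg_exponents exponents_mnm_of_seq // filter_intpart.
exists (BMultinom md); first by rewrite mem_enum.
apply/esym/mkpart_eq => /=; rewrite -/(exponents (mnm_of_seq d la)).
by rewrite exponents_mnm_of_seq // filter_intpart.
Qed.

End Partitions.

Local Open Scope ring_scope.

(** * Coordinates along the monomial symmetric functions *)

Section Coefficients.
Variable R : comNzRingType.
Implicit Types (f g : symfun R) (la nu : intpart).

(** When [s] is a partition, this is the coordinate of [f] along $m_s$, read in as many variables as
    [s] has parts. *)
Definition sfc f (s : seq nat) : R := (f (size s))@_(mnm_of_seq (size s) s).

(** Symmetry permits rearranging the exponents of [m] into [la] followed by zeros; stability then
    removes the surplus variables one at a time. *)
Lemma sfcE f n (m : 'X_{1..n}) la :
  perm_eq (exponents m) la -> (f n)@_m = sfc f la.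
Proof.
move=> pm.
have sn : (size la <= n)%N.
  rewrite -(perm_size pm) size_filter.
  by apply: leq_trans (count_size _ _) _; rewrite size_tuple.
have -> : (f n)@_m = (f n)@_(mnm_of_seq n la).
  have /tuple_permP[s sE] : perm_eq (mnm_of_seq n la) m.
    apply: perm_exponents_inj.
    by rewrite exponents_mnm_of_seq // filter_intpart perm_sym.
  have -> : mnm_of_seq n la = [multinom m (s i) | i < n].
    apply/mnmP => i; rewrite mnmE.
    by rewrite mnm_tnth (tnth_nth 0%N) sE (nth_map i) ?size_enum_ord // nth_ord_enum.
  by rewrite -mcoeff_sym; have /issymP -> := sf_sym f n.
rewrite /sfc -(subnKC sn); elim: (n - size la)%N => [|k IH]; first by rewrite addn0.
rewrite -IH addnS -[in RHS](sf_stable f) mcoeff_mrestr; congr mcoeff.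
apply/mnmP => i; rewrite mnmE.
case: (unliftP ord_max i) => [j ->|->].
  have -> : lift ord_max j = widen_ord (leqnSn _) j.
    by apply: val_inj; rewrite /= /bump leqNgt ltn_ord.
  by rewrite mnmwiden_widen mnmE.
by rewrite mnmwiden_ordmax nth_default //= leq_addr.
Qed.

Lemma sfc_mkpart f n (m : 'X_{1..n}) : (f n)@_m = sfc f (mkpart m).
Proof. by apply: sfcE; rewrite perm_sym perm_mkpart. Qed.

Lemma symfun_eq f g : (forall la : intpart, sfc f la = sfc g la) -> f = g.
Proof.
by move=> fg; apply: symfunP => n; apply/mpolyP => m; rewrite !sfc_mkpart fg.
Qed.

Lemma sfcD s f g : sfc (f + g) s = sfc f s + sfc g s.
Proof. exact: mcoeffD. Qed.

Lemma sfcZ s c f : sfc (c *: f) s = c * sfc f s.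
Proof. exact: mcoeffZ. Qed.

Lemma sfc0 s : sfc 0 s = 0.
Proof. exact: mcoeff0. Qed.

Lemma sfcB s f g : sfc (f - g) s = sfc f s - sfc g s.
Proof. exact: mcoeffB. Qed.

Lemma sfc_sum (I : Type) (r : seq I) (P : pred I) (F : I -> symfun R) s :
  sfc (\sum_(i <- r | P i) F i) s = \sum_(i <- r | P i) sfc (F i) s.
Proof. by apply: (big_morph (sfc^~ s)) => [f g|]; rewrite ?sfcD ?sfc0. Qed.

Lemma sfc_monomial la nu : sfc (monomial R la) nu = (la == nu)%:R.
Proof.
rewrite /sfc /= (@mcoeff_monsum R _ (fun n m => perm_eq (exponents m) la)).
rewrite mdeg_mnm_of_seq exponents_mnm_of_seq // filter_intpart; congr (_%:R).
rewrite [perm_eq _ _](_ : _ = (la == nu)); last first.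
  by apply/idP/eqP => [/intpart_eq-> //|->]; exact: perm_refl.
by case: eqP => [->|]; rewrite ?leqnn ?andbF.
Qed.

Lemma sfc_complete k s : sfc (complete R k) s = (sumn s == k)%:R.
Proof.
rewrite /sfc /= (@mcoeff_monsum R _ (fun n m => mdeg m == k)) mdeg_mnm_of_seq.
by case: eqP => [->|]; rewrite ?leqnn ?andbF.
Qed.

Lemma sfc_finite f : exists d, forall la, (d < sumn la)%N -> sfc f la = 0.
Proof.
have [d fd] := sf_bounded f; exists d => la dla.
apply/eqP; rewrite mcoeff_eq0; apply/negP => /msize_mdeg_lt.
rewrite mdeg_mnm_of_seq => /leq_trans /(_ (fd _)); rewrite ltnNge.
by rewrite (ltnW dla).
Qed.

Lemma monomial_expansion f : exists d,
  f = \sum_(la <- parts_le d) sfc f la *: monomial R la.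
Proof.
have [d fd] := sfc_finite f; exists d; apply: symfun_eq => nu.
rewrite sfc_sum; under eq_bigr do rewrite sfcZ sfc_monomial.
case: (leqP (sumn nu) d) => [nud|dnu].
  rewrite (bigD1_seq nu) ?undup_uniq ?mem_parts_le //= eqxx mulr1.
  by rewrite big1 ?addr0 // => la /negPf->; rewrite mulr0.
rewrite fd // big1_seq // => la /andP[_]; rewrite mem_parts_le => lad.
by case: eqP => [E|]; rewrite ?mulr0 //; move: dnu; rewrite -E ltnNge lad.
Qed.

End Coefficients.

(** * Products of power sums and complete functions; Newton's identities *)

Section Products.
Variable R : comNzRingType.
Implicit Types (f g : symfun R) (la mu nu : intpart).

Lemma mcoeffXM n (q : {mpoly R[n]}) (m a : 'X_{1..n}) :
  ('X_[m] * q)@_a = if (m <= a)%MM then q@_(a - m) else 0.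
Proof.
rewrite mulrC; case: ifP => [ma|ma]; first by rewrite -{1}(submK ma) addmC mcoeffMX.
apply/eqP; rewrite mcoeff_eq0 (perm_mem (msuppMX q m)); apply/negP.
by case/mapP => b _ E; move: ma; rewrite E lem_addr.
Qed.

(** For [k > 0] this is the partition $(k)$, so [monomial R (onerow k)] is the power sum $p_k$; for
    [k = 0] it is the empty partition. *)
Definition onerow k : intpart := mkpart [:: k].

Lemma onerowE k : (0 < k)%N -> onerow k = [:: k] :> seq nat.
Proof. by case: k. Qed.

Lemma sumn_onerow k : sumn (onerow k) = k.
Proof. by rewrite sumn_mkpart /= addn0. Qed.

Lemma exponents_onerow n (m : 'X_{1..n}) k : (0 < k)%N ->
  perm_eq (exponents m) [:: k] = [exists j, m == (U_(j) *+ k)%MM].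
Proof.
move=> k0; have mulU (j i : 'I_n) : (U_(j) *+ k)%MM i = ((j == i) * k)%N.
  by rewrite mulmnE mnm1E.
apply/idP/existsP => [p|[j /eqP->]].
  have dm : mdeg m = k by rewrite mdeg_exponents (perm_sumn p) /= addn0.
  have : k \in exponents m by rewrite (perm_mem p) inE.
  rewrite mem_filter => /andP[_ /tnthP[j kE]].
  exists j; apply/eqP/mnmP => i; rewrite mulU.
  case: eqVneq => [<-|ji]; first by rewrite mul1n mnm_tnth.
  move: dm; rewrite mdegE (bigD1 j) //= mnm_tnth -kE => /eqP.
  rewrite -[X in _ == X]addn0 eqn_add2l sum_nat_eq0 => /forallP/(_ i).
  by rewrite eq_sym ji => /eqP.
set m' := (U_(j) *+ k)%MM.
have /all_pred1P E : all (pred1 k) (exponents m').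
  apply/allP => e; rewrite mem_filter => /andP[e0 /tnthP[i eE]].
  move: e0; rewrite {e}eE -mnm_tnth mulU /=; case: (j == i) => //.
  by rewrite mul1n eqxx.
(* The nonzero exponents are copies of [k] and add up to [k], so there is just one. *)
have := mdeg_exponents m'; rewrite E sumn_nseq mdegMn mdeg1 mul1n => /eqP.
by rewrite -[X in X == _]muln1 eqn_pmul2l // eq_sym => /eqP->.
Qed.

Lemma mcoeff_complete k n (m : 'X_{1..n}) :
  (complete R k n)@_m = (mdeg m == k)%:R.
Proof.
rewrite /= (@mcoeff_monsum R _ (fun n m => mdeg m == k)).
by case: eqP => [->|]; rewrite ?leqnn ?andbF.
Qed.

Lemma mcoeff_monomial nu n (m : 'X_{1..n}) :
  (monomial R nu n)@_m = (perm_eq (exponents m) nu)%:R.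
Proof.
rewrite /= (@mcoeff_monsum R _ (fun n m => perm_eq (exponents m) nu)).
case: (boolP (perm_eq _ _)) => [p|]; rewrite ?andbF //.
by rewrite mdeg_exponents (perm_sumn p) leqnn.
Qed.

(** In [n] variables $p_k=\sum_j x_j^k$, and multiplying by $x_j^k$ merely shifts exponents. *)
Lemma mcoeff_powersumM n (q : {mpoly R[n]}) k (a : 'X_{1..n}) : (0 < k)%N ->
  (monomial R (onerow k) n * q)@_a =
  \sum_(j < n | (k <= a j)%N) q@_(a - U_(j) *+ k).
Proof.
move=> k0.
have -> : monomial R (onerow k) n = \sum_(j < n) 'X_[U_(j) *+ k].
  apply/mpolyP => m; rewrite mcoeff_monomial onerowE // exponents_onerow //.
  rewrite raddf_sum /=.
  under eq_bigr do rewrite mcoeffX.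
  case: existsP => [[j /eqP->]|nex]; last first.
    rewrite big1 // => j _; case: eqP => // E.
    by case: nex; exists j; rewrite E.
  rewrite (bigD1 j) //= eqxx big1 ?addr0 // => i ij.
  case: eqP => // /mnmP/(_ i)/eqP.
  rewrite !mulmnE !mnm1E eqxx mul1n [j == i]eq_sym (negPf ij) mul0n => /eqP E.
  by rewrite E in k0.
rewrite mulr_suml raddf_sum [RHS]big_mkcond /=; apply: eq_bigr => j _.
rewrite mcoeffXM; congr (if _ then _ else _).
apply/mnm_lepP/idP => [/(_ j)|kj i]; first by rewrite mulmnE mnm1E eqxx mul1n.
by rewrite mulmnE mnm1E; case: eqP => [<-|]; rewrite ?mul1n.
Qed.

Definition sfhomog d f := forall n (m : 'X_{1..n}), mdeg m != d -> (f n)@_m = 0.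

Lemma sfhomog_sfc d f la : sfhomog d f -> sumn la != d -> sfc f la = 0.
Proof. by move=> fd lad; rewrite /sfc fd // mdeg_mnm_of_seq. Qed.

Lemma sfhomog1 : sfhomog 0 (1 : symfun R).
Proof. by move=> n m /=; rewrite mcoeff1 mdeg_eq0 => /negPf->. Qed.

Lemma sfhomogM d e f g : sfhomog d f -> sfhomog e g -> sfhomog (d + e) (f * g).
Proof.
move=> fd ge n m /= mde; rewrite mcoeffM big1 // => k /eqP mE.
case: (eqVneq (mdeg k.1) d) => [k1|/fd->]; last by rewrite mul0r.
case: (eqVneq (mdeg k.2) e) => [k2|/ge->]; last by rewrite mulr0.
by case/eqP: mde; rewrite mE mdegD k1 k2.
Qed.

Lemma sfhomog_prod (v : nat -> symfun R) (s : seq nat) :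
  (forall k, k \in s -> sfhomog k (v k)) -> sfhomog (sumn s) (\prod_(k <- s) v k).
Proof.
elim: s => [|k s IH] hv; first by rewrite big_nil; exact: sfhomog1.
rewrite big_cons /=; apply: sfhomogM; first by apply: hv; rewrite inE eqxx.
by apply: IH => j js; apply: hv; rewrite inE js orbT.
Qed.

Lemma sfhomogD d f g : sfhomog d f -> sfhomog d g -> sfhomog d (f + g).
Proof. by move=> fd gd n m md /=; rewrite mcoeffD fd // gd // addr0. Qed.

Lemma sfhomogZ d c f : sfhomog d f -> sfhomog d (c *: f).
Proof. by move=> fd n m md /=; rewrite mcoeffZ fd // mulr0. Qed.

Lemma sfhomog0 d : sfhomog d 0.
Proof. by move=> n m _ /=; rewrite mcoeff0. Qed.

Lemma sfhomog_complete k : sfhomog k (complete R k).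
Proof. by move=> n m /negPf mk; rewrite mcoeff_complete mk. Qed.

Lemma sfhomog_monomial nu : sfhomog (sumn nu) (monomial R nu).
Proof.
move=> n m mnu; rewrite mcoeff_monomial; case: (boolP (perm_eq _ _)) => // p.
by move: mnu; rewrite mdeg_exponents (perm_sumn p) eqxx.
Qed.

Lemma complete0 : complete R 0 = 1.
Proof.
apply: symfunP => n; apply/mpolyP => m.
by rewrite mcoeff_complete /= mcoeff1 mdeg_eq0.
Qed.

(** The ring [R] carries no order, so positivity is tracked on natural number witnesses: a sum of
    naturals is positive exactly when some term is. *)
Lemma sum_natr (I : finType) (P Q : pred I) (G : I -> R) :
  (forall i, exists k, G i = k%:R /\ (0 < k)%N = Q i) ->
  exists k, \sum_(i | P i) G i = k%:R /\ (0 < k)%N = [exists i, P i && Q i].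
Proof.
move/fin_all_exists => [k Gk]; exists (\sum_(i | P i) k i)%N; split.
  by rewrite natr_sum; apply: eq_bigr => i _; case: (Gk i).
rewrite lt0n sum_nat_eq0 negb_forall; apply: eq_existsb => i.
by case: (Gk i) => _ <-; rewrite negb_imply lt0n.
Qed.

Lemma mnm_split n (m : 'X_{1..n}) d : (d <= mdeg m)%N ->
  exists2 b : 'X_{1..n}, (b <= m)%MM & mdeg b = d.
Proof.
elim: d => [_|d IH dm].
  by exists 0%MM; rewrite ?mdeg0 //; apply/mnm_lepP => i; rewrite mnm0E.
have [b bm bd] := IH (ltnW dm).
have /existsP[i bi] : [exists i, b i < m i]%N.
  apply: contraTT dm => /existsPn nb; rewrite -leqNgt -bd !mdegE leq_sum // => i _.
  by rewrite leqNgt nb.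
exists (b + U_(i))%MM; last by rewrite mdegD mdeg1 bd addn1.
apply/mnm_lepP => j; rewrite mnmDE mnm1E.
by case: eqP => [<-|_]; rewrite ?addn1 // addn0; apply/mnm_lepP.
Qed.

(** Homogeneity is included: off degree [d] the witness must be [0]. *)
Definition natcoef d f := forall n (m : 'X_{1..n}),
  exists k, (f n)@_m = k%:R /\ (0 < k)%N = (mdeg m == d).

(** Every monomial of degree [d + e] has a divisor of degree [d], whose cofactor has degree [e];
    this gives a positive term in the convolution, and in other degrees there is none. *)
Lemma natcoefM d e f g : natcoef d f -> natcoef e g -> natcoef (d + e) (f * g).
Proof.
move=> fd ge n m /=; rewrite mcoeffM.
have [|k [-> k0]] := @sum_natr _ (fun k : 'X_{1..n < (mdeg m).+1, (mdeg m).+1} =>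
    m == (k.1 + k.2)%MM) (fun k => (mdeg k.1 == d) && (mdeg k.2 == e))
    (fun k => (f n)@_k.1 * (g n)@_k.2).
  move=> k; have [a [-> a0]] := fd n k.1; have [b [-> b0]] := ge n k.2.
  by exists (a * b)%N; rewrite natrM muln_gt0 a0 b0.
exists k; split => //; rewrite k0.
apply/existsP/eqP => [[b /andP[/eqP mE /andP[/eqP b1 /eqP b2]]]|mde].
  by rewrite [LHS](congr1 mdeg mE) mdegD b1 b2.
have [|b bm bd] := @mnm_split n m d; first by rewrite mde leq_addr.
have b1 : (mdeg b < (mdeg m).+1)%N by rewrite bd mde ltnS leq_addr.
have b2 : (mdeg (m - b) < (mdeg m).+1)%N by rewrite ltnS mdegB.
exists (BMultinom b1, BMultinom b2) => /=.
rewrite addmC submK // eqxx bd eqxx /= -(eqn_add2l (mdeg b)) -mdegD addmC.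
by rewrite submK // mde bd.
Qed.

Lemma natcoef_complete_part la : natcoef (sumn la) (complete_part R la).
Proof.
rewrite /complete_part; elim: (la : seq nat) => [|k s IH].
  rewrite big_nil => n m /=; rewrite mcoeff1 mdeg_eq0.
  by exists (m == 0%MM); rewrite lt0b.
rewrite big_cons; apply: natcoefM IH => n m.
by rewrite mcoeff_complete; exists (mdeg m == k); rewrite lt0b.
Qed.

Lemma sfc_powersumM f k s : (0 < k)%N ->
  sfc (monomial R (onerow k) * f) s =
  \sum_(j < size s | (k <= nth 0%N s j)%N)
     (f (size s))@_(mnm_of_seq (size s) s - U_(j) *+ k).
Proof.
by move=> k0; rewrite /sfc /= mcoeff_powersumM //; apply: eq_bigl => j; rewrite mnmE.
Qed.

Lemma mdeg_subU n (a : 'X_{1..n}) (j : 'I_n) k : (k <= a j)%N ->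
  mdeg (a - U_(j) *+ k) = (mdeg a - k)%N.
Proof.
move=> kj; have le : (U_(j) *+ k <= a)%MM.
  apply/mnm_lepP => i; rewrite mulmnE mnm1E.
  by case: eqP => [<-|]; rewrite ?mul1n.
by rewrite -[in RHS](submK le) mdegD mdegMn mdeg1 mul1n addnK.
Qed.

(** At $x^\lambda$ with $|\lambda|=n$, the term with $p_{i+1}$ counts the variables whose exponent
    exceeds $i$. Summing over $i$ first counts the $j$-th variable $\lambda_j$ times, for a total of
    $n$. *)
Lemma newton n : n%:R *: complete R n =
  \sum_(i < n) monomial R (onerow i.+1) * complete R (n - i.+1).
Proof.
apply: symfun_eq => la; rewrite sfcZ sfc_complete sfc_sum.
have E (i : 'I_n) : sfc (monomial R (onerow i.+1) * complete R (n - i.+1)) la =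
    \sum_(j < size la) ((i < nth 0%N la j)%N && (sumn la == n))%:R.
  rewrite sfc_powersumM // big_mkcond /=; apply: eq_bigr => j _.
  case: ifP => //= ij; rewrite mcoeff_complete mdeg_subU ?mnmE // mdeg_mnm_of_seq.
  (* Both truncated subtractions are exact, so comparing [sumn la - i.+1] with [n - i.+1] amounts to
     comparing [sumn la] with [n]. *)
  have il : (i < sumn la)%N by apply: leq_trans ij (mem_sumn (mem_nth _ _)).
  by rewrite -(eqn_add2r i.+1) !subnK.
rewrite (eq_bigr _ (fun i _ => E i)) exchange_big /=.
case: (eqVneq (sumn la) n) => [lan|_]; last first.
  by rewrite mulr0 big1 // => j _; rewrite big1 // => i _; rewrite andbF.
rewrite mulr1 -{1}lan sumnE (big_nth 0%N) big_mkord natr_sum.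
apply: eq_bigr => j _; under eq_bigr do rewrite andbT.
have jn : (nth 0%N la j <= n)%N by rewrite -lan mem_sumn // mem_nth.
by rewrite -natr_sum -(big_mkord xpredT (fun i => (i < nth 0 la j)%N : nat))
  -big_mkcond /= -(big_nat_widen 0 _ n xpredT (fun=> 1%N) jn)
  sum_nat_const_nat subn0 muln1.
Qed.

(** The coefficient is a sum, over the parts $\lambda_j\ge k$, of coefficients of $h_\mu$ at
    monomials of degree $|\mu|$. All of these are positive, and such a part exists exactly when the
    first one qualifies. *)
Lemma sfc_powersum_completeM k la mu : (0 < k)%N -> sumn la = (sumn mu + k)%N ->
  exists c, sfc (complete_part R mu * monomial R (onerow k)) la = c%:R /\
    (0 < c)%N = (k <= largest_part la)%N.
Proof.
move=> k0 lamu; rewrite mulrC sfc_powersumM //.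
have [|c [-> c0]] := @sum_natr _ (fun j : 'I_(size la) => (k <= nth 0%N la j)%N)
    (fun j => mdeg (mnm_of_seq (size la) la - U_(j) *+ k)%MM == sumn mu)
    (fun j => (complete_part R mu (size la))@_(mnm_of_seq (size la) la - U_(j) *+ k)).
  by move=> j; have [c cE] := natcoef_complete_part mu
      (mnm_of_seq (size la) la - U_(j) *+ k)%MM; exists c.
exists c; split => //; rewrite c0 /largest_part -nth0.
apply/existsP/idP => [[j /andP[kj _]]|kla].
  apply: leq_trans kj _.
  have := sorted_leq_nth (fun y x z (xy : geq x y) (yz : geq y z) => leq_trans yz xy)
    leqnn 0%N (intpart_sorted la).
  by apply => //; rewrite inE // (leq_ltn_trans _ (ltn_ord j)).
have s0 : (0 < size la)%N.
  by case: (la : seq nat) kla => //=; rewrite leqNgt k0.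
exists (Ordinal s0); rewrite kla mdeg_subU ?mnmE //.
by rewrite mdeg_mnm_of_seq lamu addnK eqxx.
Qed.

End Products.

(** * Spans of products, and spanning by the $h_\lambda$ *)

Section Combinations.
Variable F : fieldType.
Implicit Types (f g : symfun F) (v : nat -> symfun F) (la mu nu : intpart).

(** Parts are nonzero, so [v 0] never occurs. *)
Definition vpart v la := \prod_(k <- la) v k.

(** Formal combinations are lists in which an index may repeat, so that adding them is
    concatenation. *)
Definition comb v (s : seq (F * intpart)) := \sum_(x <- s) x.1 *: vpart v x.2.

Definition lincomb (P : pred intpart) v f :=
  exists2 s : seq (F * intpart), all (fun x => P x.2) s & f = comb v s.

Lemma vpart_mkpart v s : 0%N \notin s ->
  vpart v (mkpart s) = \prod_(k <- s) v k.
Proof.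
move=> s0; apply: perm_big; rewrite (permPl (perm_mkpart s)).
suff /all_filterP-> : all (fun k => k != 0%N) s by [].
by apply/allP => k ks; apply: contraNneq s0 => <-.
Qed.

Lemma vpartM v la mu : vpart v la * vpart v mu = vpart v (mkpart (la ++ mu)).
Proof.
by rewrite vpart_mkpart ?big_cat // mem_cat negb_or !intpart_neq0.
Qed.

Lemma vpart_row v k : (0 < k)%N -> vpart v (onerow k) = v k.
Proof. by move=> k0; rewrite /vpart onerowE // big_seq1. Qed.

Section Closure.
Variables (P : pred intpart) (v : nat -> symfun F).

Lemma lincomb_part la : P la -> lincomb P v (vpart v la).
Proof.
by move=> Pla; exists [:: (1, la)]; rewrite /comb ?big_seq1 ?scale1r //= Pla.
Qed.

Lemma lincomb0 : lincomb P v 0.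
Proof. by exists [::]; rewrite // /comb big_nil. Qed.

Lemma lincombD f g : lincomb P v f -> lincomb P v g -> lincomb P v (f + g).
Proof.
case=> [s Ps ->] [t Pt ->]; exists (s ++ t); rewrite ?all_cat ?Ps //.
by rewrite /comb big_cat.
Qed.

Lemma lincombZ c f : lincomb P v f -> lincomb P v (c *: f).
Proof.
case=> [s Ps ->]; exists [seq (c * x.1, x.2) | x <- s]; rewrite ?all_map //.
by rewrite /comb scaler_sumr big_map; apply: eq_bigr => x _; rewrite scalerA.
Qed.

Lemma lincombB f g : lincomb P v f -> lincomb P v g -> lincomb P v (f - g).
Proof. by move=> hf hg; rewrite -scaleN1r; apply/lincombD/lincombZ. Qed.

Lemma lincomb_sum (I : eqType) (r : seq I) (Q : pred I) (G : I -> symfun F) :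
  (forall i, i \in r -> Q i -> lincomb P v (G i)) ->
  lincomb P v (\sum_(i <- r | Q i) G i).
Proof.
move=> hG; rewrite big_seq_cond; apply: big_ind => [||i /andP[]].
- exact: lincomb0.
- exact: lincombD.
- exact: hG.
Qed.

Hypothesis PM : forall la mu, P la -> P mu -> P (mkpart (la ++ mu)).

(** Products [vpart v la] multiply by merging partitions, so an index set closed under merging has a
    span closed under multiplication. All partitions form such a set, and so do those other than
    $(n)$ when $n\ge1$. *)
Lemma lincombM f g : lincomb P v f -> lincomb P v g -> lincomb P v (f * g).
Proof.
case=> [s /allP Ps ->] [t /allP Pt ->]; rewrite /comb mulr_suml.
apply: lincomb_sum => x xs _; rewrite mulr_sumr; apply: lincomb_sum => y yt _.
rewrite -scalerAl -scalerAr; do 2!apply: lincombZ.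
by rewrite vpartM; apply/lincomb_part/PM; [exact: Ps|exact: Pt].
Qed.

Hypothesis P1 : P (mkpart [::]).

Lemma lincomb1 : lincomb P v 1.
Proof.
have -> : 1 = vpart v (mkpart [::]) by rewrite /vpart big_nil.
exact: lincomb_part.
Qed.

Lemma lincomb_prod (I : eqType) (s : seq I) (w : I -> symfun F) :
  (forall k, k \in s -> lincomb P v (w k)) -> lincomb P v (\prod_(k <- s) w k).
Proof.
move=> hw; rewrite big_seq; apply: big_ind => //.
- exact: lincomb1.
- exact: lincombM.
Qed.

End Closure.

(** The last summand of Newton's identity is $p_kh_0=p_k$, so $p_k$ is isolated without division and
    the earlier power sums are covered by induction. *)
Lemma lincomb_powersum k : (0 < k)%N ->
  lincomb predT (complete F) (monomial F (onerow k)).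
Proof.
elim/ltn_ind: k => -[//|n] IH _; have := @newton F n.+1.
rewrite big_ord_recr /= subnn complete0 mulr1 => /esym/(canRL (addKr _)) ->.
rewrite addrC; apply: lincombB.
  apply: lincombZ; rewrite -(@vpart_row (complete F) n.+1) //.
  exact: lincomb_part.
apply: lincomb_sum => i _ _; apply: lincombM => //; first by apply: IH; rewrite ?ltnS.
rewrite -(@vpart_row (complete F)) ?subn_gt0 //; first exact: lincomb_part.
by rewrite ltnS.
Qed.

(** Only the exponent at [j] changes: it either disappears or stays nonzero. This controls which
    monomial functions occur in $p_km_\mu$. *)
Lemma exponents_subU n (a : 'X_{1..n}) (j : 'I_n) k : (0 < k)%N -> (k <= a j)%N ->
  if a j == k then perm_eq (k :: exponents (a - U_(j) *+ k)) (exponents a)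
  else size (exponents (a - U_(j) *+ k)) == size (exponents a).
Proof.
move=> k0 kj; pose r := rem j (enum 'I_n).
have E (b : 'X_{1..n}) :
    perm_eq (exponents b) [seq e <- b j :: [seq b i | i <- r] | e != 0%N].
  apply/perm_filter; rewrite -[_ :: _]/(map b (j :: r)).
  have -> : (b : seq nat) = map b (enum 'I_n).
    apply: (@eq_from_nth _ 0%N); first by rewrite size_map size_tuple size_enum_ord.
    move=> i; rewrite size_tuple => ilt; rewrite (nth_map (Ordinal ilt)).
      by rewrite (mnm_nth 0%N) nth_enum_ord.
    by rewrite size_enum_ord.
  by apply/perm_map/perm_to_rem; rewrite mem_enum.
have rE : [seq (a - U_(j) *+ k)%MM i | i <- r] = [seq a i | i <- r].
  apply/eq_in_map => i; rewrite mem_rem_uniq ?enum_uniq // inE => /andP[ij _].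
  by rewrite mnmBE mulmnE mnm1E eq_sym (negPf ij) subn0.
have aj : (a - U_(j) *+ k)%MM j = (a j - k)%N.
  by rewrite mnmBE mulmnE mnm1E eqxx mul1n.
move: (E a) (E (a - U_(j) *+ k)%MM); rewrite rE aj /= -lt0n (leq_trans k0 kj).
rewrite subn_eq0 leq_eqVlt ltnNge kj orbF.
set w := filter _ _ => Ea; case: eqP => [ajk|_] /= Eb.
  by rewrite (permPr Ea) ajk perm_cons.
by rewrite (perm_size Ea) (perm_size Eb).
Qed.

Hypothesis charF : [pchar F]%R =i pred0.

Lemma natf_neq0 c : (0 < c)%N -> c%:R != 0 :> F.
Proof. by move=> c0; move/pcharf0P: charF => ->; rewrite -lt0n. Qed.

(** Induction on the number of parts. With [k] the first part of [nu] and [mu] the rest, $p_km_\mu$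
    is $c\,m_\nu$ plus monomial functions with at most [size mu] parts, since [k] either becomes a
    new part or is added to an existing one. Characteristic 0 makes $c>0$ invertible. *)
Lemma lincomb_monomial nu : lincomb predT (complete F) (monomial F nu).
Proof.
have [l] := ubnP (size nu); elim: l nu => // l IH nu; rewrite ltnS => snu.
have [nu0|nu0] := posnP (size nu).
  suff -> : monomial F nu = 1 by apply: lincomb1.
  apply: symfun_eq => la; rewrite sfc_monomial /sfc mcoeff1 -mdeg_eq0.
  rewrite mdeg_mnm_of_seq; congr (nat_of_bool _)%:R; apply/eqP/eqP => [<-|la0].
    by rewrite (size0nil nu0).
  apply: intpart_eq; rewrite (size0nil nu0).
  by have := size_intpart la; rewrite la0 leqn0 => /nilP->.
pose k := head 0%N nu; pose mu := mkpart (behead nu).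
have nuE : nu = k :: behead nu :> seq nat by rewrite /k; case: (nu : seq nat) nu0.
have muE : perm_eq mu (behead nu).
  rewrite (permPl (perm_mkpart _)).
  have /all_filterP-> // : all (fun e => e != 0%N) (behead nu).
  by apply/allP => e /mem_behead; apply: contraTneq => ->; exact: intpart_neq0.
have k0 : (0 < k)%N.
  rewrite lt0n; apply: contraNneq (intpart_neq0 nu) => k0.
  by rewrite nuE inE k0.
have sizemu : (size mu).+1 = size nu by rewrite (perm_size muE) [in RHS]nuE.
pose f := monomial F (onerow k) * monomial F mu.
have fE la : exists c, sfc f la = c%:R /\ (0 < c)%N = [exists j : 'I_(size la),
    (k <= nth 0%N la j)%N &&
    perm_eq (exponents (mnm_of_seq (size la) la - U_(j) *+ k)) mu].
  rewrite sfc_powersumM //; apply: sum_natr => j; rewrite mcoeff_monomial.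
  by exists (perm_eq (exponents (mnm_of_seq (size la) la - U_(j) *+ k)%MM) mu);
    rewrite lt0b.
have fla la : la != nu -> (size mu < size la)%N -> sfc f la = 0.
  move=> lanu sla; have [c [-> /esym]] := fE la; case: (posnP c) => [->//|_].
  case/existsP=> j /andP[kj pmu].
  have := @exponents_subU _ (mnm_of_seq (size la) la) j k k0; rewrite mnmE.
  rewrite exponents_mnm_of_seq // filter_intpart => /(_ kj).
  case: ifP => _ p.
    case/eqP: lanu; apply: intpart_eq; rewrite -(permPl p) nuE perm_cons.
    exact: perm_trans pmu muE.
  by move: sla; rewrite -(eqP p) (perm_size pmu) ltnn.
have [c [cE /esym c0]] := fE nu.
have {}c0 : (0 < c)%N.
  (* The first variable carries the exponent [k]; removing it leaves [mu]. *)
  rewrite -c0; apply/existsP; exists (Ordinal nu0).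
  set a := mnm_of_seq _ _; set j := Ordinal _.
  have aj : a j = k by rewrite mnmE /= nth0.
  rewrite /= nth0 leqnn /=.
  have := @exponents_subU _ a j k k0; rewrite aj eqxx leqnn => /(_ isT).
  rewrite exponents_mnm_of_seq // filter_intpart [X in perm_eq _ X]nuE perm_cons => p.
  by rewrite (permPl p) perm_sym.
have cf0 := natf_neq0 c0.
have -> : monomial F nu = c%:R^-1 *: (f - (f - c%:R *: monomial F nu)).
  by rewrite opprB addrC subrK scalerA mulVf // scale1r.
apply/lincombZ/lincombB.
  by apply: lincombM => //; [exact: lincomb_powersum|apply: IH; rewrite sizemu].
(* The coordinates of [g] along partitions longer than [mu] vanish, the one along [nu] by the choice
   of [c]. *)
set g := f - _; have [d ->] := monomial_expansion g.
apply: lincomb_sum => la _ _; case: (eqVneq (sfc g la) 0) => [->|gla].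
  by rewrite scale0r; exact: lincomb0.
apply/lincombZ/IH/leq_trans/snu; rewrite -sizemu ltnS leqNgt.
apply: contra gla => sla; rewrite sfcB sfcZ sfc_monomial.
case: (eqVneq nu la) => [<-|nula]; first by rewrite cE mulr1 subrr.
by rewrite fla ?mulr0 ?subr0 // eq_sym.
Qed.

Lemma lincomb_complete f : lincomb predT (complete F) f.
Proof.
have [d ->] := monomial_expansion f; apply: lincomb_sum => la _ _.
exact/lincombZ/lincomb_monomial.
Qed.

End Combinations.

(** * Linear independence of spanning homogeneous products *)

Section Independence.
Variables (F : fieldType) (v : nat -> symfun F).
Hypothesis v_homog : forall k, (0 < k)%N -> sfhomog k (v k).

Lemma sfhomog_vpart (la : intpart) : sfhomog (sumn la) (vpart v la).
Proof.
apply: sfhomog_prod => k kla; apply: v_homog; rewrite lt0n.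
by apply: contraNneq (intpart_neq0 la) => <-.
Qed.

Lemma sfc_comb s (la : seq nat) :
  sfc (comb v s) la = \sum_(x <- s) x.1 * sfc (vpart v x.2) la.
Proof. by rewrite sfc_sum; under eq_bigr do rewrite sfcZ. Qed.

(** Repeated indices are gathered into one coefficient each; nothing is lost outside [P], where
    [phi] vanishes. *)
Lemma sum_collect (P : seq intpart) (t : seq (F * intpart)) (phi : intpart -> F) :
  uniq P -> (forall x, x \in t -> x.2 \notin P -> phi x.2 = 0) ->
  \sum_(x <- t) x.1 * phi x.2 =
  \sum_(la <- P) (\sum_(x <- t | x.2 == la) x.1) * phi la.
Proof.
move=> uP phi0; under [RHS]eq_bigr do rewrite mulr_suml big_mkcond.
rewrite exchange_big /=; apply: eq_big_seq => x xt.
case: (boolP (x.2 \in P)) => [xP|xP].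
  rewrite (bigD1_seq x.2) //= eqxx big1 ?addr0 // => la.
  by rewrite eq_sym => /negPf->.
rewrite phi0 // mulr0 big1_seq // => la /andP[_ laP].
by case: eqP => // xla; rewrite xla laP in xP.
Qed.

(* In degrees at most d the coefficients of the products of the v_k in the
   monomial basis form a square matrix; as the products span, it has a left
   inverse, hence a right inverse. *)
Lemma comb_inj (v_span : forall f, lincomb predT v f) s t (phi : intpart -> F) :
  comb v s = comb v t ->
  \sum_(x <- s) x.1 * phi x.2 = \sum_(x <- t) x.1 * phi x.2.
Proof.
move=> st; apply/eqP; rewrite -subr_eq0; apply/eqP.
pose r := s ++ [seq (- x.1, x.2) | x <- t].
have rE (psi : intpart -> F) : \sum_(x <- r) x.1 * psi x.2 =
    \sum_(x <- s) x.1 * psi x.2 - \sum_(x <- t) x.1 * psi x.2.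
  rewrite big_cat big_map /= -sumrN; congr (_ + _).
  by apply: eq_bigr => x _; rewrite mulNr.
rewrite -rE.
pose d := \max_(x <- r) sumn x.2; pose P := parts_le d; pose p := tnth (in_tuple P).
have pP i : p i \in P by exact: mem_tnth.
have uP : uniq P by exact: undup_uniq.
pose w i la := sfc (vpart v la) (p i).
have collect u psi := @sum_collect P u psi uP.
have C_ex (i : 'I_(size P)) : exists u, monomial F (p i) = comb v u.
  by have [u _ uE] := v_span (monomial F (p i)); exists u.
have [u uE] := fin_all_exists C_ex.
pose V := \matrix_(i, j) sfc (vpart v (p i)) (p j).
pose C := \matrix_(i, j) \sum_(x <- u i | x.2 == p j) x.1.
pose c := \row_j \sum_(x <- r | x.2 == p j) x.1.
(* Products indexed outside [P] are homogeneous of degree above [d], so cutting off at [d] does not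
   affect the coefficients considered. *)
have V0 la i : la \notin P -> sfc (vpart v la) (p i) = 0.
  rewrite mem_parts_le -ltnNge => dla; apply: (sfhomog_sfc (@sfhomog_vpart la)).
  by rewrite neq_ltn (leq_ltn_trans _ dla) // -mem_parts_le pP.
have CV : C *m V = 1%:M.
  apply/matrixP => i j; rewrite !mxE.
  have -> : (i == j) = (p i == p j).
    apply/eqP/eqP => [->//|]; rewrite /p !(tnth_nth (p i)) /= => /eqP.
    by rewrite nth_uniq // => /eqP/val_inj.
  rewrite -sfc_monomial uE sfc_comb (collect _ (w j)) => [|x _]; last exact: V0.
  by rewrite [RHS]big_tnth; apply: eq_bigr => k _; rewrite !mxE.
have cV : c *m V = 0.
  apply/rowP => j; rewrite !mxE.
  have : \sum_(x <- r) x.1 * w j x.2 = 0 by rewrite rE /w -!sfc_comb st subrr.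
  rewrite (collect _ (w j)) => [E|x _]; last exact: V0.
  by rewrite -[RHS]E [RHS]big_tnth; apply: eq_bigr => k _; rewrite !mxE.
have c0 : c = 0 by rewrite -[c]mulmx1 -(mulmx1C CV) mulmxA cV mul0mx.
rewrite (collect _ phi) => [|x xr /negP[]]; last first.
  by rewrite mem_parts_le /d (big_rem x) //= leq_maxl.
rewrite big_tnth big1 // => k _.
by have /rowP/(_ k) := c0; rewrite !mxE => ->; rewrite mul0r.
Qed.

End Independence.

(** * The Hall inner product and its representing elements *)

Section Hall.
Variable F : fieldType.
Hypothesis charF : [pchar F]%R =i pred0.
Implicit Types (f g : symfun F) (la mu nu : intpart).

Lemma scalar_comb (I : Type) (r : seq I) (phi : symfun F -> F) (c : I -> F)
    (g : I -> symfun F) : scalar phi ->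
  phi (\sum_(i <- r) c i *: g i) = \sum_(i <- r) c i * phi (g i).
Proof.
move=> phiL; have phi0 : phi 0 = 0.
  have := phiL 1 0 0; rewrite scale1r add0r mul1r => /eqP.
  by rewrite -[X in X == _]addr0 (inj_eq (addrI _)) => /eqP.
elim: r => [|i r IH]; first by rewrite !big_nil.
by rewrite !big_cons phiL IH.
Qed.

Lemma scalar_ext (phi psi : symfun F -> F) : scalar phi -> scalar psi ->
  (forall nu, phi (monomial F nu) = psi (monomial F nu)) -> phi =1 psi.
Proof.
move=> phiL psiL E f; have [d ->] := monomial_expansion f.
by rewrite !scalar_comb //; apply: eq_bigr => la _; rewrite E.
Qed.

Lemma sfc_scalar (s : seq nat) : scalar (fun f => sfc f s).
Proof. by move=> c f g; rewrite sfcD sfcZ. Qed.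

Let h := complete F.

Lemma h_homog k : (0 < k)%N -> sfhomog k (h k).
Proof. by move=> _; exact: sfhomog_complete. Qed.

Let h_comb_inj := comb_inj h_homog (lincomb_complete charF).

(** An expansion of [f] in the $h_\lambda$ is chosen and paired with the coordinates of [g] along
    the $m_\lambda$. Independence makes the value insensitive to the choice, which gives linearity
    in [f]. *)
Lemma hall_exists : exists B, @is_hall F B.
Proof.
have /choice[t tE] f : exists s, f = comb h s.
  by have [s _ sE] := lincomb_complete charF f; exists s.
have tE' f s phi : f = comb h s ->
    \sum_(x <- t f) x.1 * phi x.2 = \sum_(x <- s) x.1 * phi x.2.
  by move=> fs; apply: h_comb_inj; rewrite -tE.
exists (fun f g => \sum_(x <- t f) x.1 * sfc g x.2); split.
- move=> f c g g'; rewrite mulr_sumr -big_split; apply: eq_bigr => x _.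
  by rewrite sfcD sfcZ mulrDr mulrCA.
- move=> g c f f' /=.
  rewrite (tE' _ ([seq (c * x.1, x.2) | x <- t f] ++ t f') (sfc g)).
    rewrite big_cat big_map /= mulr_sumr; congr (_ + _).
    by apply: eq_bigr => x _; rewrite mulrA.
  rewrite {1}(tE f) {1}(tE f') /comb big_cat big_map scaler_sumr /=; congr (_ + _).
  by apply: eq_bigr => x _; rewrite scalerA.
- move=> la mu; rewrite (tE' _ [:: (1, la)] (sfc (monomial F mu))).
    by rewrite big_seq1 mul1r sfc_monomial eq_sym.
  by rewrite /comb big_seq1 scale1r.
Qed.

Lemma hallP : is_hall (@hall F).
Proof.
rewrite /hall /choose_or; case: pselect => [e|[]]; last exact: hall_exists.
exact: svalP (cid e).
Qed.

Lemma hall_complete_part la f : hall (complete_part F la) f = sfc f la.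
Proof.
have [hr _ hm] := hallP; move: f; apply: scalar_ext => // [|nu].
  exact: sfc_scalar.
by rewrite hm sfc_monomial eq_sym.
Qed.

Lemma hall_comb s f : hall (comb h s) f = \sum_(x <- s) x.1 * sfc f x.2.
Proof.
have [_ hl _] := hallP; rewrite /comb (scalar_comb _ _ _ (hl f)).
by apply: eq_bigr => x _; rewrite -hall_complete_part.
Qed.

(** By duality the coordinates of [f] along the $h_\nu$ are its pairings with the $m_\nu$. The bound
    [e] lets a caller ensure that a prescribed partition is among the indices. *)
Lemma hall_expansion f e : exists2 d, (e <= d)%N &
  f = comb h [seq (hall f (monomial F nu), nu) | nu <- parts_le d].
Proof.
have [s _ ->] := lincomb_complete charF f.
pose d := maxn e (\max_(x <- s) sumn x.2).
exists d; first exact: leq_maxl.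
apply: symfun_eq => la.
rewrite !sfc_comb big_map /=.
rewrite (@sum_collect _ (parts_le d) s (fun nu => sfc (vpart h nu) la)) ?undup_uniq //.
  apply: eq_bigr => nu _; rewrite hall_comb; congr (_ * _).
  rewrite big_mkcond; apply: eq_bigr => x _; rewrite sfc_monomial eq_sym.
  by case: eqP; rewrite ?mulr1 ?mulr0.
move=> x xs /negP[]; rewrite mem_parts_le /d leq_max (big_rem x) //=.
by rewrite leq_maxl orbT.
Qed.

(** The condition defining [skew_complete] can be met, so the chosen element satisfies it: the
    functional kills $m_\nu$ once $|\nu|>|\lambda|$, hence a finite combination of the $h_\nu$
    represents it. *)
Lemma hall_skew_complete la mu f :
  hall (skew_complete F la mu) f = sfc (complete_part F mu * f) la.
Proof.
rewrite -hall_complete_part; move: f; rewrite /skew_complete /choose_or.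
case: pselect => [e|[]]; first exact: svalP (cid e).
pose a nu := sfc (complete_part F mu * monomial F nu) la.
have a0 nu : (sumn la < sumn nu)%N -> a nu = 0.
  move=> lanu; apply: (sfhomog_sfc (d := sumn mu + sumn nu)); last first.
    by rewrite neq_ltn (leq_trans lanu) ?leq_addl.
  apply: sfhomogM (@sfhomog_monomial _ nu).
  exact: sfhomog_vpart h_homog mu.
exists (comb h [seq (a nu, nu) | nu <- parts_le (sumn la)]) => f.
rewrite hall_complete_part hall_comb; move: f.
apply: scalar_ext => [c f g|c f g|nu].
- rewrite mulr_sumr -big_split; apply: eq_bigr => x _.
  by rewrite sfcD sfcZ mulrDr mulrCA.
- by rewrite mulrDr -scalerAr sfcD sfcZ.
rewrite big_map -/(a nu); under eq_bigr do rewrite sfc_monomial.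
case: (leqP (sumn nu) (sumn la)) => nula.
  rewrite (bigD1_seq nu) ?undup_uniq ?mem_parts_le //= eqxx mulr1.
  by rewrite big1 ?addr0 // => ka; rewrite eq_sym => /negPf->; rewrite mulr0.
rewrite a0 // big1_seq // => ka /andP[_]; rewrite mem_parts_le => kala /=.
by case: eqP => [E|]; rewrite ?mulr0 //; rewrite E ltnNge kala in nula.
Qed.

End Hall.

(** * Polynomial evaluation and formal combinations *)

Section SkewSequences.
Variable F : fieldType.
Implicit Types (f g : symfun F) (v : nat -> symfun F) (la mu nu : intpart).

Lemma comb_evalN v s : exists N (p : {mpoly F[N]}), comb v s = evalN v p.
Proof.
pose d := \max_(x <- s) sumn (x : F * intpart).2.
(* Variables are numbered from [0] and [d] bounds every part, so [inord k] has value [k]. *)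
exists d.+1, (\sum_(x <- s) x.1 *: \prod_(k <- x.2) 'X_(inord k)).
rewrite /comb /evalN raddf_sum; apply: eq_big_seq => x xs /=.
rewrite mmapZ rmorph_prod /= mulr_algl; congr (_ *: _).
apply: eq_big_seq => k kx; rewrite mmapX mmap1U inordK // ltnS.
apply: leq_trans (mem_sumn kx) _.
by rewrite /d (big_rem x) //= leq_maxl.
Qed.

Lemma lincomb_evalN (P : pred intpart) v w N (p : {mpoly F[N]}) :
  (forall la mu, P la -> P mu -> P (mkpart (la ++ mu))) -> P (mkpart [::]) ->
  (forall n, lincomb P v (w n)) -> lincomb P v (evalN w p).
Proof.
move=> PM P1 wP; apply: lincomb_sum => m _ _; rewrite /= mulr_algl.
apply/lincombZ/lincomb_prod => // i _.
elim: (m i) => [|k IH]; first by rewrite expr0; exact: lincomb1.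
by rewrite exprS; apply: lincombM.
Qed.

(** The shift by one matches evaluation at the sequence starting with [v 1]. *)
Definition mnmpart N (m : 'X_{1..N}) : intpart :=
  mkpart (flatten [seq nseq (m i) i.+1 | i <- enum 'I_N]).

Lemma notin0_mnmpart N (m : 'X_{1..N}) :
  0%N \notin flatten [seq nseq (m i) i.+1 | i <- enum 'I_N].
Proof.
by apply/flattenP => -[s /mapP[i _ ->]]; rewrite mem_nseq => /andP[].
Qed.

(** The multiplicity of the part [i.+1] recovers the exponent [m i]. *)
Lemma mnmpart_inj N : injective (@mnmpart N).
Proof.
suff cnt (m : 'X_{1..N}) (i : 'I_N) : count_mem i.+1 (mnmpart m) = m i.
  by move=> m1 m2 E; apply/mnmP => i; rewrite -!cnt E.
rewrite /mnmpart.
have /seq.permP-> := perm_mkpart (flatten [seq nseq (m i) i.+1 | i <- enum 'I_N]).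
have /all_filterP-> : all (fun k => k != 0%N)
    (flatten [seq nseq (m i) i.+1 | i <- enum 'I_N]).
  by apply/allP => k kf; apply: contraNneq (notin0_mnmpart m) => <-.
rewrite count_flatten -map_comp sumnE big_map big_enum /= (bigD1 i) //=.
rewrite count_nseq /= eqxx mul1n big1 ?addn0 // => j ji.
by rewrite count_nseq /= eqSS val_eqE (negPf ji).
Qed.

Lemma vpart_mnmpart v N (m : 'X_{1..N}) :
  vpart v (mnmpart m) = mmap1 (fun i : 'I_N => v i.+1) m.
Proof.
rewrite vpart_mkpart ?notin0_mnmpart // big_flatten big_map big_enum /=.
by apply: eq_bigr => i _; rewrite big_nseq iter_mulr_1.
Qed.

(** Distinct monomials evaluate to products indexed by distinct partitions, so a polynomial relation
    is a linear relation among these products. *)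
Lemma span_alg_independent v : (forall k, (0 < k)%N -> sfhomog k (v k)) ->
  (forall f, lincomb predT v f) -> alg_independent (fun n => v n.+1).
Proof.
move=> v_homog v_span N p p0; apply/mpolyP => m; rewrite mcoeff0.
have [mp|/memN_msupp_eq0//] := boolP (m \in msupp p).
pose s := [seq (p@_k, mnmpart k) | k <- msupp p].
have s0 : comb v s = comb v [::].
  rewrite /comb big_nil big_map -[RHS]p0 /evalN /mmap; apply: eq_bigr => k _ /=.
  by rewrite mulr_algl vpart_mnmpart.
(* The indicator of [mnmpart m] extracts the coefficient at [m]. *)
have := comb_inj v_homog v_span (fun la => (mnmpart m == la)%:R) s0.
rewrite big_nil big_map => <-.
rewrite (bigD1_seq m) //= eqxx mulr1 big1 ?addr0 // => k km.
by rewrite (inj_eq (@mnmpart_inj N)) eq_sym (negPf km) mulr0.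
Qed.

Lemma intpart_row la k : k \in (la : seq nat) -> sumn la = k -> la = onerow k.
Proof.
move=> kla lak; apply: intpart_eq; have p := perm_to_rem kla.
have k0 : (0 < k)%N.
  by rewrite lt0n; apply: contraNneq (intpart_neq0 la) => <-.
rewrite onerowE // (permPl p) perm_cons.
have /eqP := perm_sumn p; rewrite /= lak -[X in X == _]addn0 eqn_add2l eq_sym.
case E : (rem k la) => [|j s] //=; rewrite addn_eq0 => /andP[/eqP j0 _].
have := intpart_neq0 la; rewrite (perm_mem p) E j0 /= !inE eqxx orbT.
by [].
Qed.

(** The part [k] lies in one of the two partitions and already exhausts the total size. *)
Lemma mkpart_cat_row la mu k : mkpart (la ++ mu) = onerow k -> (0 < k)%N ->
  la = onerow k \/ mu = onerow k.
Proof.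
move=> E k0; have p : perm_eq (la ++ mu) [:: k].
  rewrite -onerowE // -E perm_sym (permPl (perm_mkpart _)).
  by rewrite filter_cat !filter_intpart.
have ks : k \in la ++ mu by rewrite (perm_mem p) inE.
have := perm_sumn p; rewrite sumn_cat /= addn0 => s.
move: ks; rewrite mem_cat => /orP[kl|km]; [left|right]; apply: intpart_row => //;
  apply/eqP; rewrite eqn_leq mem_sumn // andbT -s; [exact: leq_addr|exact: leq_addl].
Qed.

Hypothesis charF : [pchar F]%R =i pred0.
Let h := complete F.

(** * Coordinates of a single skew complete function *)

Section OneTerm.
Variables (n : nat) (la mu : intpart).
Hypothesis la_mu : skew_partition n la mu.

(** By duality this is the coordinate of [skew_complete F la mu] along $h_\nu$. *)
Definition skew_coord nu := sfc (complete_part F mu * monomial F nu) la.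

Lemma skew_coord_eq0 nu : sumn nu != n -> skew_coord nu = 0.
Proof.
move=> nun; apply: (sfhomog_sfc (d := sumn mu + sumn nu)).
  apply: sfhomogM (@sfhomog_monomial _ nu).
  exact: sfhomog_vpart (@h_homog F) mu.
by rewrite la_mu eqn_add2l eq_sym.
Qed.

Lemma skew_expansion e : exists2 d, (e <= d)%N &
  skew_complete F la mu =
  \sum_(nu <- parts_le d) skew_coord nu *: vpart h nu.
Proof.
have [d ed E] := hall_expansion charF (skew_complete F la mu) e.
exists d => //; rewrite {1}E /comb big_map; apply: eq_bigr => nu _ /=.
by rewrite hall_skew_complete.
Qed.

Lemma skew_homog : sfhomog n (skew_complete F la mu).
Proof.
have [d _ ->] := skew_expansion 0; apply: big_ind => [||nu _].
- exact: sfhomog0.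
- exact: sfhomogD.
case: (eqVneq (sumn nu) n) => [<-|/skew_coord_eq0->].
  exact/sfhomogZ/sfhomog_vpart/h_homog.
by rewrite scale0r; exact: sfhomog0.
Qed.

Lemma skew_coord_row : (0 < n)%N ->
  (skew_coord (onerow n) != 0) = (n <= largest_part la)%N.
Proof.
move=> n0; have [c [cE <-]] := sfc_powersum_completeM F n0 la_mu.
by rewrite /skew_coord cE lt0n; have /pcharf0P-> := charF.
Qed.

End OneTerm.

(** * The two implications for a graded sequence *)

Variables la mu : nat -> intpart.
Hypothesis la_mu : forall n, skew_partition n (la n) (mu n).
Let u n := skew_complete F (la n) (mu n).

Lemma skew_generates_largest_part n : (0 < n)%N -> alg_generates u ->
  (n <= largest_part (la n))%N.
Proof.
move=> n0 u_gen; rewrite -(skew_coord_row (la_mu n)) //; apply/negP => /eqP c0.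
pose P nu := nu != onerow n.
have PM ka nu : P ka -> P nu -> P (mkpart (ka ++ nu)).
  move=> Pka Pnu; apply/negP => /eqP /mkpart_cat_row /(_ n0) [E|E].
    by rewrite /P E eqxx in Pka.
  by rewrite /P E eqxx in Pnu.
have P1 : P (mkpart [::]).
  by apply/eqP => /(congr1 (fun nu : intpart => sumn nu));
    rewrite sumn_onerow /= => E; rewrite -E in n0.
have uP k : lincomb P h (u k).
  have [d _ uE] := skew_expansion (la k) (mu k) 0; rewrite /u uE.
  apply: lincomb_sum => nu _ _; case: (eqVneq nu (onerow n)) => [->|nun].
    suff -> : skew_coord (la k) (mu k) (onerow n) = 0.
      by rewrite scale0r; exact: lincomb0.
    (* For [k] other than [n] the coordinate vanishes by degree. *)
    case: (eqVneq n k) => [<- //|nk].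
    by apply: (skew_coord_eq0 (la_mu k)); rewrite sumn_onerow.
  by apply/lincombZ/lincomb_part.
have [N [p hE]] := u_gen (h n).
have [s Ps] : lincomb P h (h n) by rewrite hE; exact: lincomb_evalN.
have {1}-> : h n = comb h [:: (1, onerow n)].
  by rewrite /comb big_seq1 scale1r vpart_row.
(* Pairing with $p_n$ reads off the coefficient of $h_n$: it is [1] on the left and [0] on the
   right, where [onerow n] is excluded. *)
move/(congr1 (fun f => hall f (monomial F (onerow n)))).
rewrite !hall_comb // big_seq1 sfc_monomial eqxx mul1r big1_seq.
  by move/eqP; rewrite oner_eq0.
move=> x /= xs; rewrite sfc_monomial eq_sym; move/allP: Ps => /(_ _ xs) /negPf->.
by rewrite mulr0.
Qed.

(** Strong induction on [n] for [h n]: its coefficient in [u n] is invertible, and any other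
    partition of [n] has all its parts below [n]. *)
Lemma lincomb_skew : (forall n, (0 < n)%N -> (n <= largest_part (la n))%N) ->
  forall f, lincomb predT u f.
Proof.
move=> u_large.
have hu n : (0 < n)%N -> lincomb predT u (h n).
  (* The bound [n] puts [onerow n] among the indices of the expansion. *)
  elim/ltn_ind: n => n IH n0; have [d nd] := skew_expansion (la n) (mu n) n.
  set a := skew_coord _ _; rewrite (bigD1_seq (onerow n)) ?undup_uniq //=; last first.
    by rewrite mem_parts_le sumn_onerow.
  have a0 : a (onerow n) != 0 by rewrite (skew_coord_row (la_mu n)) // u_large.
  rewrite vpart_row // => /esym/(canRL (addrK _)) /(congr1 ( *:%R (a (onerow n))^-1)).
  rewrite scalerA mulVf // scale1r => ->; apply/lincombZ/lincombB.
    by rewrite -/(u n) -(vpart_row u n0); exact: lincomb_part.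
  apply: lincomb_sum => nu _ nun; case: (eqVneq (sumn nu) n) => [snu|]; last first.
    move/(skew_coord_eq0 (la_mu n)); rewrite -/(a nu) => ->.
    by rewrite scale0r; exact: lincomb0.
  apply/lincombZ/lincomb_prod => // k knu; apply: IH.
    rewrite ltn_neqAle -{2}snu mem_sumn // andbT.
    apply: contraNneq nun => kn; apply/eqP/intpart_row => //.
    by rewrite -kn.
  by rewrite lt0n; apply: contraNneq (intpart_neq0 nu) => <-.
move=> f; have [s _ ->] := lincomb_complete charF f.
apply: lincomb_sum => x _ _; apply/lincombZ/lincomb_prod => // k kx.
by apply: hu; rewrite lt0n; apply: contraNneq (intpart_neq0 x.2) => <-.
Qed.

End SkewSequences.
Local Close Scope ring_scope.

Theorem theorem3p8 (F : fieldType) (charF : [pchar F]%R =i pred0)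
    (la mu : nat -> intpart)
    (la_mu : forall n, skew_partition n (la n) (mu n)) :
  let u n := skew_complete F (la n) (mu n) in
  (alg_independent (fun n => u n.+1) /\ alg_generates u) <->
  (forall n, 1 <= n -> n <= largest_part (la n)).
Proof.
move=> u; split=> [[_ u_gen] n n0|u_large].
  exact: skew_generates_largest_part u_gen.
have u_span := lincomb_skew charF la_mu u_large; split.
  by apply: span_alg_independent u_span => k _; exact: skew_homog.
by move=> f; have [s _ ->] := u_span f; exact: comb_evalN.
Qed.
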